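(* Let $\mathbb{K}\in\{\mathbb{R},\mathbb{C}\}$. Let $(\mathcal{X},d_{\mathcal{X}})$ be a metric space having the input-EDAP and let $(\mathcal{Y},d_{\mathcal{Y}})$ be a metric space having the output-EDAP. Let $E_n^{\mathcal{X}}, D_n^{\mathcal{X}}$ and $E_n^{\mathcal{Y}}, D_n^{\mathcal{Y}}$ ($n\in\mathbb{N}$) be encoders and decoders as in the definitions of the input-EDAP of $\mathcal{X}$ and of the output-EDAP of $\mathcal{Y}$, respectively, with dimensions $w_{\mathcal{X}}(n)$ and $w_{\mathcal{Y}}(n)$. Let $\mathcal{F}$ be a universal function approximator. Then for every continuous $G:\mathcal{X}\to\mathcal{Y}$ there exists a sequence $(\varphi_n)_{n\in\mathbb{N}}$ in $\mathcal{F}$, with $\varphi_n:\mathbb{K}^{w_{\mathcal{X}}(n)}\to\mathbb{K}^{w_{\mathcal{Y}}(n)}$, such that for every compact $K\subseteq\mathcal{X}$ $$\sup_{f\in K} d_{\mathcal{Y}}\Big(G(f),\,\big(D_n^{\mathcal{Y}}\circ\varphi_n\circ E_n^{\mathcal{X}}\big)(f)\Big)\xrightarrow{n\to\infty}0 .$$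
   Context: $|\cdot|$ is the Euclidean norm on $\mathbb{K}^m$. Input-EDAP: a metric space $(\mathcal{X},d)$ has the input-EDAP if there are mappings $E_n^{\mathcal{X}}:\mathcal{X}\to\mathbb{K}^{w_{\mathcal{X}}(n)}$ (encoders, possibly discontinuous, $w_{\mathcal{X}}(n)\in\mathbb{N}$) and $D_n^{\mathcal{X}}:\overline{E_n^{\mathcal{X}}(\mathcal{X})}\to\mathcal{X}$ (decoders), $n\in\mathbb{N}$, such that: (i) there is $r:\mathbb{N}\to(0,\infty)$ such that for each compact $K\subseteq\mathcal{X}$ there is $N_K\in\mathbb{N}$ with $\sup_{f\in K}|E_n^{\mathcal{X}}(f)|\le r(n)$ for all $n\ge N_K$; (ii) each $D_n^{\mathcal{X}}$ is continuous; (iii) for every compact $K\subseteq\mathcal{X}$, $\sup_{f\in K} d(f,D_n^{\mathcal{X}}(E_n^{\mathcal{X}}(f)))\to0$ as $n\to\infty$. Output-EDAP: a metric space $(\mathcal{Y},d)$ has the output-EDAP if there are mappings $E_n^{\mathcal{Y}}:\mathcal{Y}\to\mathbb{K}^{w_{\mathcal{Y}}(n)}$ and $D_n^{\mathcal{Y}}:\mathbb{K}^{w_{\mathcal{Y}}(n)}\to\mathcal{Y}$, $n\in\mathbb{N}$, such that: (i) each $E_n^{\mathcal{Y}}$ is continuous; (ii) each $D_n^{\mathcal{Y}}$ is uniformly continuous; (iii) for every compact $K\subseteq\mathcal{Y}$, $\sup_{f\in K} d(f,D_n^{\mathcal{Y}}(E_n^{\mathcal{Y}}(f)))\to0$ as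 $n\to\infty$. Universal function approximator: a set $\mathcal{F}$ of functions $\mathbb{K}^a\to\mathbb{K}^b$ (with varying $a,b\in\mathbb{N}$; members may be discontinuous) such that for any $a,b\in\mathbb{N}$, compact $K\subset\mathbb{K}^a$ and continuous $f:K\to\mathbb{K}^b$ there is a sequence $(f_n)_{n\in\mathbb{N}}$ of functions $\mathbb{K}^a\to\mathbb{K}^b$ in $\mathcal{F}$ with $\sup_{x\in K}|f(x)-f_n(x)|\to0$. *)

(* Defs.v *)
From HB Require Import structures.
From mathcomp Require Import all_boot all_order all_algebra.
From mathcomp Require Import complex.
From mathcomp Require Import all_classical all_reals all_analysis.

Set Implicit Arguments.
Unset Strict Implicit.
Unset Printing Implicit Defensive.

Import Order.TTheory GRing.Theory Num.Theory.
Import numFieldNormedType.Exports.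

Local Open Scope classical_set_scope.
Local Open Scope ring_scope.

Inductive scalar_kind := RealScalars | ComplexScalars.

(* Typing both fields as a [numFieldType] gives row vectors over them the
   library's product topology and uniformity, which are also the ones induced
   by the Euclidean norm. *)
Definition scalar_field (R : realType) (k : scalar_kind) : numFieldType :=
  match k with
  | RealScalars => R
  | ComplexScalars => R[i]
  end.

(* The norm of [R[i]] takes its values in [R[i]]; [Normc.normc] is the same
   modulus with values in [R]. *)
Definition modulus (R : realType) (k : scalar_kind) : scalar_field R k -> R :=
  match k return scalar_field R k -> R with
  | RealScalars => fun x : R => `|x|
  | ComplexScalars => fun z : R[i] => ComplexField.Normc.normc z
  end.

(* Needed because the library's norm on matrices is the maximum norm. *)
Definition euclidean_norm (R : realType) (k : scalar_kind) (m : nat)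
    (x : 'rV[scalar_field R k]_m) : R :=
  Num.sqrt (\sum_(i < m) modulus (x 0 i) ^+ 2).

(* Supremum in [0, +oo] of a nonnegative function: the supremum over the empty
   set is 0, whereas [ereal_sup set0] is -oo. *)
Definition sup_on (R : realType) (T : Type) (A : set T) (g : T -> R) : \bar R :=
  ereal_sup (0%E |` [set (g x)%:E | x in A]).

Section ApproximationProperties.
Variables (R : realType) (k : scalar_kind).

Definition to_closure_range (X : Type) (T : topologicalType) (E : X -> T)
    (x : X) : closure (range E) :=
  SigSub (mem_set (subset_closure (imageT E x))).

Definition input_EDAP_with (X : metricType R) (w : nat -> nat)
    (E : forall n, X -> 'rV[scalar_field R k]_(w n))
    (D : forall n, closure (range (E n)) -> X) : Prop :=
  [/\ exists r : nat -> R,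
        (forall n, 0 < r n) /\
        (forall A : set X, compact A ->
           exists N : nat, forall n, (N <= n)%N ->
             (sup_on A (fun f => euclidean_norm (E n f)) <= (r n)%:E)%E),
      forall n, continuous (D n)
    & forall A : set X, compact A ->
        sup_on A (fun f => mdist f (D n (to_closure_range (E n) f)))
          @[n --> \oo] --> 0%E].

Definition output_EDAP_with (Y : metricType R) (w : nat -> nat)
    (E : forall n, Y -> 'rV[scalar_field R k]_(w n))
    (D : forall n, 'rV[scalar_field R k]_(w n) -> Y) : Prop :=
  [/\ forall n, continuous (E n),
      forall n, unif_continuous (D n)
    & forall A : set Y, compact A ->
        sup_on A (fun f => mdist f (D n (E n f))) @[n --> \oo] --> 0%E].

Definition universal_approximator
    (F : forall a b : nat, set ('rV[scalar_field R k]_a -> 'rV[scalar_field R k]_b))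
    : Prop :=
  forall (a b : nat) (A : set 'rV[scalar_field R k]_a)
         (f : 'rV[scalar_field R k]_a -> 'rV[scalar_field R k]_b),
    compact A -> {within A, continuous f} ->
    exists f_ : nat -> 'rV[scalar_field R k]_a -> 'rV[scalar_field R k]_b,
      (forall n, F a b (f_ n)) /\
      sup_on A (fun x => euclidean_norm (f x - f_ n x)) @[n --> \oo] --> 0%E.

End ApproximationProperties.

(* Main.v *)
Require Import Defs.
From HB Require Import structures.
From mathcomp Require Import all_boot all_order all_algebra.
From mathcomp Require Import complex.
From mathcomp Require Import all_classical all_reals all_analysis.
From mathcomp Require Import lra.

(** Let [B] be the part, inside the ball of radius [r n], of the closure of the
range of the encoder [E] of [X]. It is compact, and [E' o G o D] is continuous
on it, where [D] is the decoder of [X] and [E'], [D'] are those of [Y]. Let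
[phi] in [F] approximate this map on [B] so well that, by uniform continuity of
[D'], the error after decoding is less than [1 / n.+1]. For [f] in a compact
set [A] it remains to compare [G f] with [D' (E' (G x))], where [x = D (E f)].
The points [x] need not stay in a fixed compact set, but they are uniformly
close to [A]. Since [D' o E' o G] tends to [G] uniformly on compact sets, it
does so locally uniformly, and finitely many of the neighbourhoods obtained
cover [A]. *)

Import Order.TTheory GRing.Theory Num.Theory.
Import numFieldNormedType.Exports.

Local Open Scope classical_set_scope.
Local Open Scope ring_scope.

(** * Suprema of nonnegative functions and uniform convergence to 0 *)

Section SupOn.
Context {R : realType} {T : Type}.
Implicit Types (A : set T) (g : T -> R).

Lemma sup_on_ge0 A g : (0 <= sup_on A g)%E.
Proof. by apply: ereal_sup_ubound; left. Qed.

Lemma sup_on_leP A g (e : R) : 0 <= e ->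
  (sup_on A g <= e%:E)%E <-> (forall x, A x -> g x <= e).
Proof.
move=> e0; split=> [h x Ax|h].
  rewrite -lee_fin; apply: le_trans h; apply: ereal_sup_ubound.
  by right; exists x.
by apply: ge_ereal_sup => _ [->|[x Ax <-]]; rewrite lee_fin// h.
Qed.

Lemma sup_on_cvg0P A (g : nat -> T -> R) :
  sup_on A (g n) @[n --> \oo] --> 0%E <->
  (forall e, 0 < e -> \forall n \near \oo, forall x, A x -> g n x <= e).
Proof.
split=> [h e e0|h].
  have : \forall y \near (0 : \bar R)%E, (y <= e%:E)%E.
    exists e => //= x /=; rewrite sub0r normrN => xe.
    by rewrite lee_fin (le_trans (ler_norm _))// ltW.
  move/h; rewrite /= nbhs_simpl => he.
  near=> n; apply/(sup_on_leP _ _ _ (ltW e0)); near: n; exact: he.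
move=> B [e /= e0 Be].
have e20 : 0 < e / 2 by lra.
apply: filterS (h _ e20) => n /(sup_on_leP _ _ _ (ltW e20)) /=.
have := sup_on_ge0 A (g n).
case: (sup_on A (g n)) => //= s; rewrite !lee_fin => s0 se.
apply: Be => /=; rewrite sub0r normrN ger0_norm// (le_lt_trans se)//.
lra.
Unshelve. all: by end_near. Qed.

End SupOn.

(** * Compactness and uniform continuity for the Euclidean norm *)

Section ScalarField.
Context {R : realType}.

Lemma real_complex_continuous :
  continuous (real_complex R : R -> (R[i] : numFieldType)).
Proof.
move=> x; apply/cvgrPdist_lt => e e0.
(* Radii in [R[i]] are themselves complex; positivity forces the imaginary part to vanish. *)
have [d d0 ->] : exists2 d : R, 0 < d & e = real_complex R d.
  case: e e0 => a b; rewrite ltcE /= => /andP[/eqP -> a0].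
  by exists a.
near=> y; rewrite -rmorphB normc_def /= expr0n /= addr0 sqrtr_sqr ltcR.
by near: y; apply: cvgr_dist_lt => //; exact: cvg_id.
Unshelve. all: by end_near. Qed.

Lemma modulus_ball (k : scalar_kind) (e : scalar_field R k) : 0 < e ->
  exists2 d : R, 0 < d & forall x y, modulus (x - y) < d -> ball x e y.
Proof.
case: k e => /= [e e0|[a b]]; first by exists e.
rewrite ltcE /= => /andP[/eqP -> a0]; exists a => // x y.
rewrite /ball /= normc_def ltcR.
by case: (x - y).
Qed.

Lemma modulus_le_compact (k : scalar_kind) (r : R) :
  exists2 B : set (scalar_field R k), compact B &
    forall x, modulus x <= r -> B x.
Proof.
case: k => /=.
  exists `[- r, r]%classic; first exact: segment_compact.
  by move=> x; rewrite /= in_itv /= ler_norml.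
(* The disc of radius [r] lies in the image of the compact square with side [[-r, r]] under
   [(a, b) -> a + ib]. *)
pose f (p : R * R) : (R[i] : numFieldType) :=
  real_complex R p.1 + 'i%C * real_complex R p.2.
exists (f @` (`[- r, r]%classic `*` `[- r, r]%classic)).
  apply: continuous_compact; last first.
    by apply: compact_setX; exact: segment_compact.
  apply: continuous_subspaceT => p; apply: cvgD.
    apply: (@cvg_comp _ _ _ fst (real_complex R) _ (nbhs p.1)).
      exact: cvg_fst.
    exact: real_complex_continuous.
  apply: cvgMr.
  apply: (@cvg_comp _ _ _ snd (real_complex R) _ (nbhs p.2)).
    exact: cvg_snd.
  exact: real_complex_continuous.
move=> [a b] /= abr; exists (a, b); last first.
  by rewrite /f /=; simpc.
have abs (c d : R) : `|c| <= Num.sqrt (c ^+ 2 + d ^+ 2).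
  by rewrite -sqrtr_sqr ler_wsqrtr// lerDl sqr_ge0.
by split; rewrite /= in_itv /= -ler_norml (le_trans _ abr)// addrC.
Qed.

Lemma modulus_le_euclidean_norm (k : scalar_kind) m
    (x : 'rV[scalar_field R k]_m) i : modulus (x 0 i) <= euclidean_norm x.
Proof.
rewrite /euclidean_norm (bigD1 i)//=.
apply: (le_trans (ler_norm _)).
by rewrite -sqrtr_sqr ler_wsqrtr// lerDl sumr_ge0// => j _; exact: sqr_ge0.
Qed.

(** Heine-Borel by coordinates: in the ball every coordinate lies in one compact set of scalars, and
    a product of compact sets is compact. Intersecting with the closed set [C] keeps it compact. *)
Lemma euclidean_ball_compact (k : scalar_kind) m (r : R)
    (C : set 'rV[scalar_field R k]_m) :
  closed C ->
  exists B, [/\ compact B, B `<=` C &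
    [set x | C x /\ euclidean_norm x <= r] `<=` B].
Proof.
move=> clC; have [B Bc Br] := modulus_le_compact k r.
exists ([set v : 'rV_m | forall i, B (v 0 i)] `&` C); split.
- apply: compact_closedI => //.
  exact: (@rV_compact _ _ (fun=> B)).
- by move=> x [].
- move=> x [Cx xr]; split=> // i; apply: Br.
  exact: le_trans (modulus_le_euclidean_norm _ _ _ _) xr.
Qed.

Lemma unif_continuous_euclidean (k : scalar_kind) m (Y : metricType R)
    (D : 'rV[scalar_field R k]_m -> Y) (e : R) : unif_continuous D -> 0 < e ->
  exists2 d : R, 0 < d &
    forall x y, euclidean_norm (x - y) < d -> mdist (D x) (D y) < e.
Proof.
move=> Du e0.
have /Du : entourage [set xy : Y * Y | ball xy.1 e xy.2]
  by rewrite -entourage_from_ballE; exists e.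
rewrite /= nbhs_simpl -entourage_from_ballE => -[c /= c0 cD].
have [d d0 dc] := modulus_ball _ _ c0; exists d => // x y xyd.
have : ball (D x) e (D y).
  apply: (cD (x, y)); split=> //= i j; apply: dc; rewrite ord1.
  apply: le_lt_trans xyd.
  by have := modulus_le_euclidean_norm _ _ (x - y) j; rewrite !mxE.
by rewrite ballEmdist.
Qed.

End ScalarField.

(** * From uniform convergence on compact sets to perturbed compact sets *)

Section CompactPerturbation.
Context {R : realType}.

(** A neighbourhood of [c] absorbs a tail of the sequence; the finitely many remaining terms are
    added one by one by induction. *)
Lemma compact_cvg_range (T : topologicalType) (u : nat -> T) (c : T) :
  u n @[n --> \oo] --> c -> compact (c |` range u).
Proof.
move=> uc; apply/compact_near_coveringP => I F P FF FP.
have [[U V] /= [cU FV] UV] := FP c (or_introl erefl).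
have [N _ NU] := uc _ cU.
have Fu : \forall i \near F, forall n, (n < N)%N -> P i (u n).
  elim: N {NU} => [|N IHN]; first exact: nearW.
  have [[U' V'] /= [cU' FV'] UV'] := FP (u N) (or_intror (imageT u N)).
  near=> i.
  have IHi : forall n, (n < N)%N -> P i (u n) by near: i.
  move=> n; rewrite ltnS leq_eqVlt => /predU1P[->|]; last exact: IHi.
  apply: (UV' (u N, i)); split => /=; first exact: nbhs_singleton.
  by near: i.
near=> i.
have iP : forall n, (n < N)%N -> P i (u n) by near: i.
move=> _ [->|[n _ <-]].
  apply: (UV (c, i)); split => /=; first exact: nbhs_singleton.
  by near: i.
have [Nn|nN] := leqP N n; last exact: iP.
apply: (UV (u n, i)); split => /=; first exact: NU.
by near: i.
Unshelve. all: by end_near. Qed.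

(* If h is large at points x_j -> c for indices n_j -> oo, then it does not
   tend to 0 uniformly on the compact set {c, x_0, x_1, ...}. *)
Lemma compact_uniform_locally_uniform (X : metricType R) (h : nat -> X -> R) :
  (forall B, compact B -> forall e, 0 < e ->
    \forall n \near \oo, forall x, B x -> h n x <= e) ->
  forall c e, 0 < e -> exists2 d, 0 < d &
    \forall n \near \oo, forall x, mdist c x < d -> h n x <= e.
Proof.
move=> hB c e e0; apply: contrapT => hc.
have /choice[f fP] (j : nat) : exists p : nat * X,
    [/\ (j <= p.1)%N, mdist c p.2 < j.+1%:R^-1 & e < h p.1 p.2].
  apply: contrapT => hj; apply: hc; exists j.+1%:R^-1 => //.
  exists j => //= n /= jn x cx; rewrite leNgt; apply/negP => ehx.
  by apply: hj; exists (n, x).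
have fc : (f j).2 @[j --> \oo] --> c.
  apply/metricType_numDomainType.cvgrPdist_lt => r r0.
  near=> j; have [_ /lt_trans + _] := fP j; apply.
  by near: j; exact: near_infty_natSinv_lt (PosNum r0).
have [N _ /(_ (f N).1) NB] := hB _ (compact_cvg_range _ _ _ fc) _ e0.
have [Nf _] := fP N.
by rewrite ltNge NB//; right; exists N.
Unshelve. all: by end_near. Qed.

(** If [a] is within [d / 2] of [c] and [p n a] within [d / 2] of [a], both lie in the [d]-ball of
    [c], where [P] holds for large [n]. Compactness makes one threshold serve all centres. *)
Lemma near_compact_perturbation (X : metricType R) (A : set X)
    (p : nat -> X -> X) (P : nat -> X -> X -> Prop) : compact A ->
  (forall d, 0 < d ->
    \forall n \near \oo, forall a, A a -> mdist a (p n a) <= d) ->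
  (forall c, A c -> exists2 d, 0 < d & \forall n \near \oo,
     forall a x, mdist c a < d -> mdist c x < d -> P n a x) ->
  \forall n \near \oo, forall a, A a -> P n a (p n a).
Proof.
move=> /compact_near_coveringP cA pA PA.
(* Neighbourhoods of [c] may leave [A], where [p n] is not controlled; hence [A a] is kept as a
   premise inside the covered property. *)
suff : \forall n \near \oo, A `<=` (fun a => A a -> P n a (p n a)).
  by apply: filterS => n h a Aa; exact: h.
apply: cA => c /PA[d d0 Pd].
have d20 : 0 < d / 2 by rewrite divr_gt0.
exists (ball c (d / 2), [set n | (forall a, A a -> mdist a (p n a) <= d / 2) /\
    forall a x, mdist c a < d -> mdist c x < d -> P n a x]) => /=.
  split; first exact: nbhsx_ballx.
  by apply: filterI => //; exact: pA.
move=> [a n] /= [+ [pn Pn]] Aa; rewrite ballEmdist /= => ca.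
apply: Pn; first by rewrite (lt_trans ca)//; lra.
rewrite (le_lt_trans (metric_triangle _ a _))// [ltRHS]splitr.
by rewrite ltr_leD// pn.
Qed.

End CompactPerturbation.

Lemma approximator_on_ball (R : realType) (k : scalar_kind) (m l : nat)
    (Y : metricType R) (C : set 'rV[scalar_field R k]_m)
    (F : forall a b : nat, set ('rV[scalar_field R k]_a -> 'rV[scalar_field R k]_b))
    (D : 'rV[scalar_field R k]_l -> Y) (g : C -> 'rV[scalar_field R k]_l)
    (r e : R) :
  universal_approximator F -> closed C -> unif_continuous D -> continuous g ->
  0 < e ->
  exists phi, F m l phi /\ forall y : C, euclidean_norm (set_val y) <= r ->
    mdist (D (g y)) (D (phi (set_val y))) < e.
Proof.
move=> hF clC Du gc e0.
have [B [Bc BC rB]] := euclidean_ball_compact k m r C clC.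
have [d d0 dD] := unif_continuous_euclidean _ _ _ _ _ Du e0.
(* Extension of [g] by 0 outside [C]; it is continuous within [C], hence within [B]. *)
pose f := valL_ 0 g.
have fc : {within B, continuous f}.
  by apply: (continuous_subspaceW BC); apply/subspace_valL_continuousP'.
have [f_ [Ff_ /sup_on_cvg0P f_cvg]] := hF _ _ _ _ Bc fc.
have d20 : 0 < d / 2 by rewrite divr_gt0.
have [N _ /(_ N (leqnn N)) fN] := f_cvg _ d20.
exists (f_ N); split=> // y yr.
have -> : g y = f (set_val y) by rewrite -[in LHS](valLK 0 g).
apply: dD; apply: (@le_lt_trans _ _ (d / 2)).
  by apply: fN; apply: rB; split=> //; exact: set_valP.
lra.
Qed.

Theorem theorem4p5 (R : realType) (k : scalar_kind)
    (X Y : metricType R) (wX wY : nat -> nat)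
    (EX : forall n, X -> 'rV[scalar_field R k]_(wX n))
    (DX : forall n, closure (range (EX n)) -> X)
    (EY : forall n, Y -> 'rV[scalar_field R k]_(wY n))
    (DY : forall n, 'rV[scalar_field R k]_(wY n) -> Y)
    (F : forall a b : nat, set ('rV[scalar_field R k]_a -> 'rV[scalar_field R k]_b))
    (hX : input_EDAP_with DX)
    (hY : output_EDAP_with EY DY)
    (hF : universal_approximator F)
    (G : X -> Y) (hG : continuous G) :
  exists phi : forall n, 'rV[scalar_field R k]_(wX n) -> 'rV[scalar_field R k]_(wY n),
    (forall n, F (wX n) (wY n) (phi n)) /\
    (forall A : set X, compact A ->
       sup_on A (fun f => mdist (G f) ((DY n \o phi n \o EX n) f))
         @[n --> \oo] --> 0%E).
Proof.
case: hX => -[r [r0 hr]] DXc hXcvg; case: hY => EYc DYu hYcvg.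
pose g n : closure (range (EX n)) -> 'rV[scalar_field R k]_(wY n) :=
  EY n \o G \o DX n.
have gc n : continuous (g n).
  move=> y; apply: continuous_comp; first exact: DXc.
  by apply: continuous_comp; [exact: hG|exact: EYc].
have H n := approximator_on_ball R k _ _ Y _ F (DY n) (g n) (r n) n.+1%:R^-1
  hF (@closed_closure _ _) (DYu n) (gc n) (ltac:(by rewrite invr_gt0)).
(* The choice depends only on [n], through [r n] and the tolerance [n.+1%:R^-1], so one sequence
   serves every compact [A]. *)
exists (fun n => sval (cid (H n))).
split=> [n|A cA]; first by case: (svalP (cid (H n))).
apply/sup_on_cvg0P => e e0.
have e6 : 0 < e / 6 by lra.
have e2 : 0 < e / 2 by lra.
pose p n x := DX n (to_closure_range (EX n) x).
pose h n x := mdist (G x) (DY n (EY n (G x))).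
have hB B : compact B -> forall e, 0 < e ->
    \forall n \near \oo, forall x, B x -> h n x <= e.
  move=> cB e' e'0.
  have cGB : compact (G @` B).
    by apply: continuous_compact => //; exact: continuous_subspaceT.
  have /sup_on_cvg0P/(_ _ e'0) := hYcvg _ cGB.
  by apply: filterS => n hn x Bx; apply: hn; exists x.
have GDE : \forall n \near \oo, forall a, A a ->
    mdist (G a) (DY n (EY n (G (p n a)))) <= e / 2.
  apply: (@near_compact_perturbation _ _ _ p (fun n a x =>
    mdist (G a) (DY n (EY n (G x))) <= e / 2)) => //.
    by move=> d d0; have /sup_on_cvg0P/(_ _ d0) := hXcvg _ cA.
  move=> c _.
  (* Three terms of size [e / 6] add up to [e / 2]: from [G a] to [G c], from [G c] to [G x] (both
     by [d2]), and [h n x] (by [d1]). *)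
  have [d1 d10 hd1] := compact_uniform_locally_uniform _ _ hB c _ e6.
  have /metricType_numDomainType.cvgrPdist_lt/(_ _ e6) := hG c.
  move=> /metricType_numDomainType.nbhs_mdistP[d2 /= d20 hd2].
  exists (Num.min d1 d2); first by rewrite lt_min d10.
  apply: filterS hd1 => n hn a x; rewrite !lt_min => /andP[_ /hd2 /= ca].
  move=> /andP[/hn hnx /hd2 /= cx].
  have := metric_triangle (G a) (G c) (DY n (EY n (G x))).
  have := metric_triangle (G c) (G x) (DY n (EY n (G x))).
  rewrite (metric_sym (G a) (G c)); rewrite /h in hnx; lra.
have [N hN] := hr _ cA.
near=> n.
have GDEn : forall a, A a -> mdist (G a) (DY n (EY n (G (p n a)))) <= e / 2.
  by near: n.
move=> a Aa /=; have an := GDEn a Aa.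
(* For large [n] the codes of [A] enter the ball on which [phi n] was controlled. *)
have rn : euclidean_norm (EX n a) <= r n.
  have Nn : (N <= n)%N by near: n; exact: nbhs_infty_ge.
  by have /sup_on_leP/(_ a Aa) := hN _ Nn; apply; exact: ltW.
have [_ /(_ (to_closure_range (EX n) a) rn) phin] := svalP (cid (H n)).
have en : n.+1%:R^-1 < e / 2.
  by near: n; exact: near_infty_natSinv_lt (PosNum e2).
apply: (le_trans (metric_triangle _ (DY n (EY n (G (p n a)))) _)).
by rewrite [leRHS]splitr lerD//; exact/ltW/(lt_trans phin).
Unshelve. all: by end_near. Qed.
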